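(* For every conjugacy class $C_{\lambda,\mu}$ of $B_n$, \[\mathbb{E}_{\lambda,\mu}[\operatorname{inv}]=\frac{n(n-1)}{4}-\frac{n-3}{12}\Delta^1(\lambda,\mu)-\frac16\Delta^2(\lambda,\mu),\qquad \mathbb{E}_{\lambda,\mu}[\operatorname{inv}_B]=\frac{n^2}{2}-\frac n3\Delta^1(\lambda,\mu)-\frac16\Delta^2(\lambda,\mu).\]
   Context: $B_n$ is the group of permutations $\omega$ of $\{\pm1,\dots,\pm n\}$ with $\omega(-i)=-\omega(i)$. $\operatorname{inv}(\omega)=|\{(i,j)\in[n]^2:i<j,\ \omega(i)>\omega(j)\}|$, $\operatorname{neg}(\omega)=\sum_{i\in[n],\,\omega(i)<0}\omega(i)$, and $\operatorname{inv}_B=\operatorname{inv}-\operatorname{neg}$ (the Coxeter length with respect to the generators $s_0=[-1,2,\dots,n]$ and the adjacent transpositions). A cycle of $\omega$ is a cycle of $|\omega|:i\mapsto|\omega(i)|$; it is even (odd) if the number of its elements $i$ with $\omega(i)<0$ is even (odd). The cycle type is the bi-partition $(\lambda,\mu)$ with $\lambda$ the lengths of even cycles and $\mu$ those of odd cycles; $C_{\lambda,\mu}$ is its conjugacy class and $\mathbb{E}_{\lambda,\mu}$ the uniform expectation on it. $\Delta^k(\lambda,\mu)=m_1(\lambda)^k-m_1(\mu)^k$ with $m_1(\cdot)$ the number of parts equal to $1$. *)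

(* Defs.v *)
From mathcomp Require Import all_boot all_order all_algebra all_fingroup.

Set Implicit Arguments.
Unset Strict Implicit.
Unset Printing Implicit Defensive.

Import GRing.Theory Num.Theory.
Local Open Scope ring_scope.

(* {±1, ..., ±n}: the pair (i, s), with i : 'I_n counted from 0, stands for
   i + 1 if s = false and for -(i + 1) if s = true. *)
Definition signed (n : nat) : finType := ('I_n * bool)%type.

Definition signed_val (n : nat) (x : signed n) : int :=
  if x.2 then - (x.1.+1)%:Z else (x.1.+1)%:Z.

Definition signed_opp (n : nat) (x : signed n) : signed n := (x.1, ~~ x.2).

Definition hyperoct (n : nat) : {set {perm signed n}} :=
  [set w : {perm signed n} | [forall x, w (signed_opp x) == signed_opp (w x)]].

Lemma hyperoct_group_set (n : nat) : group_set (hyperoct n).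
Proof.
apply/group_setP; split=> [|u v].
  by rewrite inE; apply/forallP=> x; rewrite !perm1.
rewrite !inE => /forallP hu /forallP hv; apply/forallP=> x.
by rewrite !permM (eqP (hu x)) (eqP (hv (u x))).
Qed.

Canonical hyperoct_group (n : nat) : {group {perm signed n}} :=
  Group (hyperoct_group_set n).

Notation Bn n := (subg_of (hyperoct_group n)).

Definition entry (n : nat) (w : Bn n) (i : 'I_n) : signed n :=
  sgval w ((i, false) : signed n).

Definition inv_num (n : nat) (w : Bn n) : nat :=
  #|[set p : 'I_n * 'I_n |
      (p.1 < p.2)%N && (signed_val (entry w p.2) < signed_val (entry w p.1))]|.

Definition neg_sum (n : nat) (w : Bn n) : int :=
  \sum_(i < n | signed_val (entry w i) < 0) signed_val (entry w i).

Definition inv_B (n : nat) (w : Bn n) : int := (inv_num w)%:Z - neg_sum w.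

Lemma abs_entry_inj (n : nat) (w : Bn n) :
  injective (fun i : 'I_n => (entry w i).1).
Proof.
move=> i j; have := subgP w; rewrite inE => /forallP hw.
rewrite /entry; set u := sgval w in hw *.
case: (eqVneq (u (i, false)).2 (u (j, false)).2) => [e2 e1|n2 e1].
  have /perm_inj : u (i, false) = u (j, false).
    by rewrite [LHS]surjective_pairing e1 e2 -surjective_pairing.
  by case.
have := eqP (hw (j, false)); rewrite /signed_opp /= -e1.
have -> : ~~ (u (j, false)).2 = (u (i, false)).2.
  by move: n2; case: (u (i, false)).2; case: (u (j, false)).2.
by rewrite -surjective_pairing => /perm_inj [].
Qed.

Definition abs_perm (n : nat) (w : Bn n) : {perm 'I_n} :=
  perm (@abs_entry_inj n w).

(* Parity is that of the number of negative entries on the cycle, not that of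
   its length. *)
Definition odd_cycle (n : nat) (w : Bn n) (c : {set 'I_n}) : bool :=
  odd #|[set i in c | signed_val (entry w i) < 0]|.

(* Partitions are weakly decreasing sequences of positive integers. *)
Definition cycle_type (n : nat) (w : Bn n) : seq nat * seq nat :=
  (sort geq [seq #|(c : {set 'I_n})| |
      c <- enum (porbits (abs_perm w)) & ~~ odd_cycle w c],
   sort geq [seq #|(c : {set 'I_n})| |
      c <- enum (porbits (abs_perm w)) & odd_cycle w c]).

Definition Delta (k : nat) (lambda mu : seq nat) : rat :=
  (count_mem 1%N lambda)%:R ^+ k - (count_mem 1%N mu)%:R ^+ k.

Definition expectation (n : nat) (C : {set Bn n}) (X : Bn n -> int) : rat :=
  (\sum_(w in C) (X w)%:~R) / #|C|%:R.

(* Main.v *)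
(* Write eps_i for the sign and pi(i) for the absolute value of the i-th entry
   of v. In the pair (i, j) the sign of the entry with the larger absolute value
   decides whether there is an inversion, so inv, like neg, is affine in the
   signs. Conjugation by the sign change at i negates eps_i when pi(i) <> i and
   fixes pi, so on average only the fixed points i of pi contribute. Reversing
   {1, ..., n} turns the remaining comparisons into products
   cmp(i, j) cmp(i, pi(j)); these are 1 when pi(j) = j, and otherwise average to
   1/3 under the rotations of the three points i, j, pi(j). What is left only
   involves the numbers of positive and of negative fixed points. *)
Require Import Defs.
From mathcomp Require Import all_boot all_order all_algebra all_fingroup.
From mathcomp Require Import ring lra zify.

Set Implicit Arguments.
Unset Strict Implicit.
Unset Printing Implicit Defensive.

Import Order.TTheory GRing.Theory Num.Theory.
Local Open Scope ring_scope.

(** * Signed permutations, their fixed points and conjugation *)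

Definition eps (n : nat) (v : Bn n) (i : 'I_n) : rat := (-1) ^+ (entry v i).2.

(** The part of [eps] that survives averaging over a conjugacy class. *)
Definition sigma (n : nat) (v : Bn n) (i : 'I_n) : rat :=
  eps v i * (abs_perm v i == i)%:R.

Definition cmp (n : nat) (i j : 'I_n) : rat := (i < j)%:R - (j < i)%:R.

Lemma abs_permE (n : nat) (v : Bn n) (i : 'I_n) : abs_perm v i = (entry v i).1.
Proof. by rewrite permE. Qed.

Lemma signed_val_lt0 (n : nat) (x : signed n) : (signed_val x < 0) = x.2.
Proof. by rewrite /signed_val; case: x => i [] /=; lia. Qed.

Lemma sgval_opp (n : nat) (v : Bn n) (x : signed n) :
  sgval v (signed_opp x) = signed_opp (sgval v x).
Proof. by have := subgP v; rewrite inE => /forallP /(_ x) /eqP. Qed.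

Lemma sgval_conj (n : nat) (v g : Bn n) (x : signed n) :
  sgval (v ^ g)%g (sgval g x) = sgval g (sgval v x).
Proof.
have := congr1 (fun u => sgval u) (conjgC v g).
by rewrite /= => /permP /(_ x); rewrite !permM => ->.
Qed.

(** Every element of the group has this form ([hyperoct_signed_elt]). The averaging arguments
    conjugate by two kinds: one sign change with [p = 1], and plain permutations with
    [f = xpred0]. *)
Definition signed_map (n : nat) (p : {perm 'I_n}) (f : 'I_n -> bool)
  (x : signed n) : signed n := (p x.1, x.2 (+) f x.1).

Lemma signed_map_inj (n : nat) (p : {perm 'I_n}) (f : 'I_n -> bool) :
  injective (signed_map p f).
Proof. by move=> [i b] [j c] [] /perm_inj -> /addIb ->. Qed.

Lemma signed_map_hyperoct (n : nat) (p : {perm 'I_n}) (f : 'I_n -> bool) :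
  perm (@signed_map_inj n p f) \in hyperoct_group n.
Proof.
rewrite inE; apply/forallP => x; rewrite !permE /signed_map /signed_opp /=.
by rewrite addNb.
Qed.

Definition signed_elt (n : nat) (p : {perm 'I_n}) (f : 'I_n -> bool) : Bn n :=
  Subg (signed_map_hyperoct p f).

Lemma signed_eltE (n : nat) (p : {perm 'I_n}) (f : 'I_n -> bool) x :
  sgval (signed_elt p f) x = (p x.1, x.2 (+) f x.1).
Proof. exact: permE. Qed.

Lemma entry_conj (n : nat) (v : Bn n) (p : {perm 'I_n}) (f : 'I_n -> bool) i :
  entry (v ^ signed_elt p f)%g (p i) =
  (p (abs_perm v i), (entry v i).2 (+) f i (+) f (abs_perm v i)).
Proof.
(* [signed_elt p f] sends [(i, f i)] to [(p i, false)], the point at which the entry is read. *)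
have := sgval_conj v (signed_elt p f) (i, f i).
rewrite !signed_eltE [_.1]/= addbb abs_permE /entry => ->.
case: (f i); rewrite ?addbF //.
by rewrite -[(i, true)]/(signed_opp (i, false)) sgval_opp /= addbT.
Qed.

Lemma abs_perm_conj (n : nat) (v : Bn n) (p : {perm 'I_n}) f i :
  abs_perm (v ^ signed_elt p f)%g (p i) = p (abs_perm v i).
Proof. by rewrite abs_permE entry_conj. Qed.

(** At a fixed point the sign changes [f i] and [f (abs_perm v i)] cancel; elsewhere both sides
    vanish. *)
Lemma sigma_conj (n : nat) (v : Bn n) (p : {perm 'I_n}) f i :
  sigma (v ^ signed_elt p f)%g (p i) = sigma v i.
Proof.
rewrite /sigma abs_perm_conj (inj_eq perm_inj); case: eqP => [e|_].
  by rewrite /eps entry_conj /= e addbK.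
by rewrite !mulr0.
Qed.

Lemma hyperoct_signed_elt (n : nat) (g : Bn n) :
  g = signed_elt (abs_perm g) (fun i => (entry g i).2).
Proof.
apply: val_inj; apply/permP => -[i b]; rewrite signed_eltE abs_permE /=.
case: b => /=; last by rewrite -surjective_pairing.
by rewrite -[(i, true)]/(signed_opp (i, false)) sgval_opp.
Qed.

(** * Inversions and negative sums as affine functions of the signs *)

Lemma signed_val_lt (n : nat) (x y : signed n) : x.1 != y.1 ->
  (signed_val y < signed_val x) = if (y.1 < x.1)%N then ~~ x.2 else y.2.
Proof.
case: x y => [i a] [j b]; rewrite -val_eqE /signed_val /= => ne.
by case: ltnP; case: a; case: b; lia.
Qed.

Lemma sum_ord_lt (n : nat) :
  2 * \sum_(i < n) \sum_(j < n) (i < j)%:R = n%:R * (n%:R - 1) :> rat.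
Proof.
have e : \sum_(i < n) \sum_(j < n) ((i < j)%:R + (j < i)%:R + (j == i)%:R) =
    n%:R * n%:R :> rat.
  under eq_bigr => i _.
    under eq_bigr => j _.
      rewrite (_ : _ + _ = 1); last first.
        by rewrite -val_eqE /=; case: ltngtP; rewrite ?addr0 ?add0r.
    over.
    rewrite sumr_const card_ord; over.
  by rewrite sumr_const card_ord mulr_natl.
have e1 : \sum_(i < n) \sum_(j < n) (j == i)%:R = n%:R :> rat.
  under eq_bigr => i _.
    rewrite (bigD1 i) //= eqxx big1 ?addr0; last by move=> j /negPf ->.
    over.
  by rewrite sumr_const card_ord.
move: e; under eq_bigr do rewrite !big_split /=.
rewrite !big_split /= e1
  (exchange_big _ _ _ _ _ (fun i j : 'I_n => (j < i)%:R)) /=.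
by move=> e; rewrite mulrBr mulr1 -e; ring.
Qed.

(** For [i < j], the inversion indicator is [(1 + eps v i) / 2] if the larger absolute value is at
    [i], and [(1 - eps v j) / 2] if it is at [j]. Exchanging the names [i] and [j] in the second
    kind of term produces [cmp]. *)
Lemma inv_numE (n : nat) (v : Bn n) :
  4 * (inv_num v)%:R = n%:R * (n%:R - 1) +
    2 * \sum_i \sum_j eps v i * (cmp i j * (abs_perm v j < abs_perm v i)%:R).
Proof.
have -> : (inv_num v)%:R = \sum_(i < n) \sum_(j < n) ((i < j)%N &&
    (signed_val (entry v j) < signed_val (entry v i)))%:R :> rat.
  rewrite pair_bigA /inv_num -sum1_card natr_sum /= big_mkcond /=.
  by apply: eq_bigr => p _; rewrite inE; case: ifP.
rewrite -sum_ord_lt -mulrDr -[4]/(2 * 2)%:R natrM -mulrA; congr (_ * _).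
transitivity (\sum_(i < n) \sum_(j < n) ((i < j)%:R
    + (i < j)%:R * (eps v i * (abs_perm v j < abs_perm v i)%:R)
    - (i < j)%:R * (eps v j * (abs_perm v i < abs_perm v j)%:R))).
  rewrite mulr_sumr; apply: eq_bigr => i _.
  rewrite mulr_sumr; apply: eq_bigr => j _.
  case: ltnP => [lt_ij|_]; last by rewrite /=; ring.
  have ne : (entry v i).1 != (entry v j).1.
    by rewrite (inj_eq (@abs_entry_inj _ v)) neq_ltn lt_ij.
  rewrite /= signed_val_lt // !abs_permE /eps.
  move: ne; rewrite -val_eqE /=.
  case: (ltngtP (entry v i).1 (entry v j).1) => // _ _.
    by case: (entry v j).2; rewrite /= ?expr0 ?expr1; ring.
  by case: (entry v i).2; rewrite /= ?expr0 ?expr1; ring.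
under eq_bigr do rewrite !big_split /= sumrN.
rewrite !big_split /= sumrN (exchange_big _ _ _ _ _
  (fun i j : 'I_n =>
    (i < j)%:R * (eps v j * (abs_perm v i < abs_perm v j)%:R))) /=.
rewrite -addrA -sumrB; congr (_ + _); apply: eq_bigr => i _.
by rewrite -sumrB; apply: eq_bigr => j _; rewrite /cmp; ring.
Qed.

Lemma sum_ord_succ (n : nat) :
  2 * \sum_(i < n) (i.+1)%:R = n%:R * (n%:R + 1) :> rat.
Proof.
elim: n => [|n IHn]; first by rewrite big_ord0; ring.
by rewrite big_ord_recr /= mulrDr IHn -natr1; ring.
Qed.

(** The entry at [i] contributes [(1 - eps v i) / 2] times its absolute value to [- neg_sum v], and
    the absolute values run through 1, ..., n. *)
Lemma neg_sumE (n : nat) (v : Bn n) :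
  - 4 * (neg_sum v)%:~R = n%:R * (n%:R + 1) -
    2 * \sum_i eps v i * (abs_perm v i).+1%:R.
Proof.
rewrite -sum_ord_succ (reindex_inj (@perm_inj _ (abs_perm v))) /=.
rewrite -mulrBr -sumrB -[4]/(2 * 2)%:R natrM -mulNr -mulrA.
rewrite mulNr -mulrN; congr (_ * _).
rewrite /neg_sum big_mkcond rmorph_sum /= -mulrN -sumrN mulr_sumr.
apply: eq_bigr => i _; rewrite signed_val_lt0 abs_permE /eps /signed_val.
case: (entry v i).2; rewrite /= ?expr0 ?expr1 ?rmorphN /=.
  by rewrite pmulrn; ring.
by ring.
Qed.

(** * Fixed points and the parts equal to 1 of the cycle type *)

Definition sigma_sum (n : nat) (v : Bn n) : rat := \sum_i sigma v i.

Definition fix_sum (n : nat) (v : Bn n) : rat := \sum_i (abs_perm v i == i)%:R.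

Lemma sigma_sum_conj (n : nat) (v g : Bn n) : sigma_sum (v ^ g)%g = sigma_sum v.
Proof.
rewrite (hyperoct_signed_elt g) /sigma_sum.
rewrite (reindex_inj (@perm_inj _ (abs_perm g))) /=.
by apply: eq_bigr => i _; rewrite sigma_conj.
Qed.

Lemma fix_sum_conj (n : nat) (v g : Bn n) : fix_sum (v ^ g)%g = fix_sum v.
Proof.
rewrite (hyperoct_signed_elt g) /fix_sum.
rewrite (reindex_inj (@perm_inj _ (abs_perm g))) /=.
by apply: eq_bigr => i _; rewrite abs_perm_conj (inj_eq perm_inj).
Qed.

(** The orbits of size 1 are the singletons of fixed points, and sorting does not affect a count. *)
Lemma count_porbits1 (T : finType) (p : {perm T}) (P : pred {set T}) :
  count_mem 1%N (sort geq
    [seq #|(c : {set T})| | c <- enum (porbits p) & P c]) =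
  #|[set x | (p x == x) && P [set x]]|.
Proof.
rewrite (seq.permP (permEl (perm_sort _ _))) count_map count_filter.
rewrite -size_filter -(card_imset _ set1_inj) cardE.
apply: perm_size; apply: uniq_perm;
  rewrite ?enum_uniq 1?filter_uniq ?enum_uniq // => c.
rewrite mem_filter !mem_enum /=; apply/andP/imsetP.
  case=> /andP[/cards1P[x ->] Px] /imsetP[y _ e].
  have yx : y = x by apply/set1P; rewrite e porbit_id.
  exists x => //; rewrite inE Px andbT; apply/eqP/set1P.
  by rewrite e yx -{1}(expg1 p) mem_porbit.
case=> x; rewrite inE => /andP[/eqP px Px] ->; rewrite cards1 Px; split=> //.
apply/imsetP; exists x => //; apply/setP => y; rewrite inE.
apply/eqP/porbitP => [->|[k ->]]; first by exists 0%N; rewrite perm1.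
by elim: k => [|k IHk]; rewrite ?perm1 // expgSr permM IHk.
Qed.

Lemma odd_cycle1 (n : nat) (w : Bn n) i : odd_cycle w [set i] = (entry w i).2.
Proof.
rewrite /odd_cycle; case e: (entry w i).2.
  rewrite (_ : [set _ in _ | _] = [set i]) ?cards1 //.
  apply/setP => j; rewrite !inE signed_val_lt0.
  by case: eqP => // ->; rewrite e.
rewrite (_ : [set _ in _ | _] = set0) ?cards0 //.
apply/setP => j; rewrite !inE signed_val_lt0.
by case: eqP => // ->; rewrite e.
Qed.

Lemma count_fixed (n : nat) (w : Bn n) (b : bool) :
  2 * #|[set i | (abs_perm w i == i) && ((entry w i).2 == b)]|%:R =
  fix_sum w + (-1) ^+ b * sigma_sum w.
Proof.
rewrite -sum1_card natr_sum /= big_mkcond /= /fix_sum /sigma_sum.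
rewrite !mulr_sumr -big_split.
apply: eq_bigr => i _; rewrite inE /sigma /eps /=.
by case: eqP => _; case: b; case: (entry w i).2; rewrite /= ?expr0 ?expr1; ring.
Qed.

(** With [a] positive and [b] negative fixed points, [sigma_sum w = a - b] and [fix_sum w = a + b],
    and the difference of squares factors. *)
Lemma Delta_cycle_type (n : nat) (w : Bn n) (lambda mu : seq nat) :
  cycle_type w = (lambda, mu) ->
  Delta 1 lambda mu = sigma_sum w /\
  Delta 2 lambda mu = sigma_sum w * fix_sum w.
Proof.
case=> <- <-; rewrite /Delta !count_porbits1.
have -> : [set x | (abs_perm w x == x) && ~~ odd_cycle w [set x]] =
    [set i | (abs_perm w i == i) && ((entry w i).2 == false)].
  by apply/setP => i; rewrite !inE odd_cycle1 eqbF_neg.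
have -> : [set x | (abs_perm w x == x) && odd_cycle w [set x]] =
    [set i | (abs_perm w i == i) && ((entry w i).2 == true)].
  by apply/setP => i; rewrite !inE odd_cycle1 eqb_id.
have := count_fixed w false; have := count_fixed w true.
move: #|_|%:R #|_|%:R => a b /=; rewrite expr0 !expr1 mul1r mulN1r => hb ha.
have -> : sigma_sum w = a - b by lra.
have -> : fix_sum w = a + b by lra.
by split; ring.
Qed.

(** * Signs of comparisons *)

Lemma cmp_rev (n : nat) (i j : 'I_n) : cmp (rev_ord i) (rev_ord j) = cmp j i.
Proof.
rewrite /cmp /=; have := ltn_ord i; have := ltn_ord j => hj hi.
have -> : (n - i.+1 < n - j.+1)%N = (j < i)%N by lia.
by have -> : (n - j.+1 < n - i.+1)%N = (i < j)%N by lia.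
Qed.

(** [cmp i j * cmp i k] is 1 when [i] is the least or the greatest of the three points and -1 when
    it lies between, so the total is 1 - 1 + 1. *)
Lemma cmp_cyclic (n : nat) (i j k : 'I_n) : i != j -> j != k -> i != k ->
  cmp i j * cmp i k + cmp j k * cmp j i + cmp k i * cmp k j = 1.
Proof.
rewrite -!val_eqE /cmp /=.
by case: (ltngtP i j); case: (ltngtP j k); case: (ltngtP i k) => // *;
  do [exfalso; lia | ring].
Qed.

Lemma cmp_sqr (n : nat) (i j : 'I_n) : cmp i j * cmp i j = (j != i)%:R.
Proof. by rewrite -val_eqE /cmp /=; case: (ltngtP i j) => * /=; ring. Qed.

(** * Averages over a conjugacy class *)

Section ConjugacyClass.

Variables (n : nat) (C : {set Bn n}).
Hypothesis hC : C \in classes [set: Bn n].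

Lemma sum_conj (X : Bn n -> rat) g :
  \sum_(v in C) X (v ^ g)%g = \sum_(v in C) X v.
Proof.
rewrite [RHS](reindex_inj (conjg_inj g)) /=; apply: eq_bigl => v.
have /imsetP[w _ eC] := hC; rewrite eC; apply/imsetP/imsetP => -[x _ e].
  by exists (x * g)%g; rewrite ?inE // conjgM -e.
by exists (x * g^-1)%g; rewrite ?inE // conjgM -e conjgK.
Qed.

Lemma sum_eps (F : {perm 'I_n} -> rat) m :
  \sum_(v in C) eps v m * F (abs_perm v) =
  \sum_(v in C) sigma v m * F (abs_perm v).
Proof.
set t := signed_elt 1%g (pred1 m).
have tP v : abs_perm (v ^ t)%g = abs_perm v.
  by apply/permP => i; have := abs_perm_conj v 1%g (pred1 m) i; rewrite !perm1.
(* If [m] is moved the two signs are opposite; if [m] is fixed they agree. *)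
have te v : eps (v ^ t)%g m + eps v m = 2 * sigma v m.
  rewrite /sigma /eps -[m in entry (v ^ t)%g m](perm1 m) entry_conj /= eqxx.
  by case: eqP => _; case: (entry v m).2; rewrite /= ?expr0 ?expr1; ring.
suff e : \sum_(v in C) eps v m * F (abs_perm v) +
    \sum_(v in C) eps v m * F (abs_perm v) =
    2 * \sum_(v in C) sigma v m * F (abs_perm v) by lra.
rewrite -{1}(sum_conj _ t) -big_split mulr_sumr /=; apply: eq_bigr => v _.
by rewrite tP -mulrDl te mulrA.
Qed.

(** [sigma_sum] and [fix_sum] are class functions. The factor [a + b * fix_sum v] will be
    [fix_sum v - 1], [n - fix_sum v] and [n + 1]. *)
Lemma sum_sigma_class (w : Bn n) (a b : rat) : w \in C ->
  \sum_(v in C) sigma_sum v * (a + b * fix_sum v) =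
  #|C|%:R * (sigma_sum w * (a + b * fix_sum w)).
Proof.
have /imsetP[x _ eC] := hC; rewrite eC => wC.
rewrite mulr_natl -sumr_const; apply: eq_bigr => v vC.
have /imsetP[y _ ev] := vC; have /imsetP[z _ ew] := wC.
by rewrite ev ew !sigma_sum_conj !fix_sum_conj.
Qed.

Lemma sum_sigma_rot (m j k : 'I_n) : m != j -> j != k -> m != k ->
  \sum_(v in C) sigma v m * (abs_perm v j == k)%:R =
  \sum_(v in C) sigma v j * (abs_perm v k == m)%:R.
Proof.
(* The 3-cycle sending [m] to [j], [j] to [k] and [k] to [m]; in a product the left factor acts
   first. *)
move=> mj jk mk; set p := (tperm m j * tperm m k)%g.
have pm : p m = j by rewrite permM tpermL tpermD // eq_sym.
have pj : p j = k by rewrite permM tpermR tpermL.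
have pk : p k = m by rewrite permM [tperm m j k]tpermD ?tpermR.
rewrite -[RHS](sum_conj _ (signed_elt p xpred0)); apply: eq_bigr => v _.
have := sigma_conj v p xpred0 m; have := abs_perm_conj v p xpred0 j.
by rewrite pm pj => -> ->; rewrite -(inj_eq (@perm_inj _ p)) pk.
Qed.

Let distinct (m j k : 'I_n) : rat := [&& m != j, j != k & m != k]%:R.

(** By [sum_sigma_rot] the class sum of a distinct triple is unchanged by rotation, so its weight
    may be averaged over the three rotations; by [cmp_cyclic] that average is 1/3. *)
Lemma sum_sigma_distinct :
  3 * \sum_(v in C) \sum_i \sum_j \sum_k
    distinct i j k * (cmp i j * cmp i k) *
      (sigma v i * (abs_perm v j == k)%:R) =
  \sum_(v in C) \sum_i \sum_j \sum_k
    distinct i j k * (sigma v i * (abs_perm v j == k)%:R).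
Proof.
pose Q i j k := \sum_(v in C) sigma v i * (abs_perm v j == k)%:R.
have toQ (c : 'I_n -> 'I_n -> 'I_n -> rat) :
  \sum_(v in C) \sum_i \sum_j \sum_k c i j k *
    (sigma v i * (abs_perm v j == k)%:R)
  = \sum_i \sum_j \sum_k c i j k * Q i j k.
  rewrite exchange_big; apply: eq_bigr => i _; rewrite exchange_big.
  apply: eq_bigr => j _; rewrite exchange_big; apply: eq_bigr => k _.
  by rewrite mulr_sumr.
rewrite !toQ.
have dQ i j k : distinct i j k * Q i j k = distinct i j k * Q j k i.
  rewrite /distinct; case: and3P => [[ij jk ik]|_]; last by rewrite !mul0r.
  by rewrite /Q sum_sigma_rot.
have drot i j k : distinct i j k = distinct j k i.
  rewrite /distinct (eq_sym k i) (eq_sym j i).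
  by case: (i == j); case: (j == k); case: (i == k).
pose S (c : 'I_n -> 'I_n -> 'I_n -> rat) :=
  \sum_i \sum_j \sum_k distinct i j k * c i j k * Q i j k.
(* Relabelling the indices rotates [distinct], [c] and [Q] together; on distinct triples only [c]
   notices. *)
have rotate c : S c = S (fun i j k => c j k i).
  pose G i j k := distinct i j k * c i j k * Q i j k.
  transitivity (\sum_i \sum_j \sum_k G j k i).
    rewrite [RHS]exchange_big; apply: eq_bigr => i _ /=.
    by rewrite [RHS]exchange_big.
  apply: eq_bigr => i _; apply: eq_bigr => j _; apply: eq_bigr => k _.
  by rewrite /G -(drot i j k) mulrAC -dQ mulrAC.
pose c (i j k : 'I_n) := cmp i j * cmp i k.
have -> : 3 * S c = S c + S (fun i j k => c j k i) + S (fun i j k => c k i j).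
  by rewrite -(rotate (fun i j k => c j k i)) -(rotate c); ring.
rewrite /S -!big_split; apply: eq_bigr => i _.
rewrite -!big_split; apply: eq_bigr => j _.
rewrite -!big_split; apply: eq_bigr => k _.
rewrite /= -!mulrDl -!mulrDr /c /distinct; case: and3P => [[ij jk ik]|_].
  by rewrite cmp_cyclic ?mulr1.
by rewrite !mul0r.
Qed.

Lemma sum_eps_cmp :
  2 * \sum_(v in C) \sum_i \sum_j
    eps v i * (cmp i j * (abs_perm v j < abs_perm v i)%:R) =
  - \sum_(v in C) \sum_i \sum_j sigma v i * (cmp i j * cmp i (abs_perm v j)).
Proof.
(* Only fixed [i] survive the average, and there [abs_perm v i] is [i]. *)
have -> : \sum_(v in C) \sum_i \sum_j
    eps v i * (cmp i j * (abs_perm v j < abs_perm v i)%:R) =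
  \sum_(v in C) \sum_i \sum_j sigma v i * (cmp i j * (abs_perm v j < i)%:R).
  rewrite exchange_big [RHS]exchange_big; apply: eq_bigr => i _ /=.
  under eq_bigr do rewrite -mulr_sumr.
  rewrite (sum_eps (fun p => \sum_j cmp i j * (p j < p i)%:R)).
  apply: eq_bigr => v _; rewrite mulr_sumr; apply: eq_bigr => j _.
  by rewrite /sigma; case: eqP => [->|_] //; rewrite !mulr0 !mul0r.
(* One of the two copies is conjugated by the reversal, which flips both comparisons. The copies add
   up to [cmp i j] times [(abs_perm v j < i) - (i < abs_perm v j)], and this difference is
   [- cmp i (abs_perm v j)]. *)
rewrite mulr_natl mulr2n; pose p := perm (@rev_ord_inj n).
rewrite -{1}(sum_conj _ (signed_elt p xpred0)) -big_split -sumrN /=.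
apply: eq_bigr => v _.
rewrite (reindex_inj (@perm_inj _ p)) -big_split -sumrN /=.
apply: eq_bigr => i _.
rewrite (reindex_inj (@perm_inj _ p)) -big_split -sumrN /=.
apply: eq_bigr => j _.
have pE k : p k = rev_ord k by exact: permE.
rewrite sigma_conj abs_perm_conj !pE cmp_rev /cmp /=.
rewrite (_ : (n - _ < n - _)%N = (i < abs_perm v j)%N); first by ring.
by have := ltn_ord i; have := ltn_ord (abs_perm v j); lia.
Qed.

(** Here [k] is forced to be [abs_perm v j], and for a fixed [i] the triple is distinct exactly when
    [j] is moved. *)
Lemma sigma_distinct_sum v :
  \sum_i \sum_j \sum_k distinct i j k * (sigma v i * (abs_perm v j == k)%:R) =
  sigma_sum v * (n%:R - fix_sum v).
Proof.
rewrite /sigma_sum mulr_suml; apply: eq_bigr => i _.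
have -> : n%:R = \sum_(j < n) 1 :> rat by rewrite sumr_const card_ord.
rewrite /fix_sum -sumrB mulr_sumr; apply: eq_bigr => j _.
rewrite (bigD1 (abs_perm v j)) //= eqxx mulr1 big1 ?addr0; last first.
  by move=> k /negPf; rewrite eq_sym => ->; rewrite !mulr0.
rewrite /sigma /distinct; case: (abs_perm v i =P i) => [e|_]; last first.
  by rewrite !(mulr0, mul0r).
case: (eqVneq i j) => [<-|ij] /=; first by rewrite e eqxx /=; ring.
have -> /= : i != abs_perm v j by rewrite -{1}e (inj_eq perm_inj).
by rewrite andbT eq_sym; case: eqP => _ /=; ring.
Qed.

(** For a fixed [i], the term [j = i] vanishes, each of the other [fix_sum v - 1] fixed points [j]
    gives the square of [cmp i j], which is 1, and a moved [j] gives a distinct triple. *)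
Lemma sum_sigma_split v :
  \sum_i \sum_j sigma v i * (cmp i j * cmp i (abs_perm v j)) =
  sigma_sum v * (fix_sum v - 1) + \sum_i \sum_j \sum_k
    distinct i j k * (cmp i j * cmp i k) *
      (sigma v i * (abs_perm v j == k)%:R).
Proof.
rewrite /sigma_sum mulr_suml -big_split; apply: eq_bigr => i _ /=.
have -> : sigma v i * (fix_sum v - 1) =
    \sum_j sigma v i * ((abs_perm v j == j) && (j != i))%:R.
  rewrite -mulr_sumr /sigma.
  case: eqP => [e|_]; last by rewrite mulr0 !mul0r.
  congr (_ * _); rewrite /fix_sum (bigD1 i) //= e eqxx addrAC subrr add0r.
  rewrite [RHS](bigD1 i) //= eqxx andbF add0r; apply: eq_bigr => j ji.
  by rewrite ji andbT.
rewrite -big_split; apply: eq_bigr => j _ /=.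
rewrite (bigD1 (abs_perm v j)) //= eqxx mulr1 big1 ?addr0; last first.
  by move=> k /negPf; rewrite eq_sym => ->; rewrite !mulr0.
rewrite /sigma /distinct; case: (abs_perm v i =P i) => [e|_]; last first.
  by rewrite !(mulr0, mul0r) add0r.
case: (eqVneq i j) => [<-|ij] /=; first by rewrite e eqxx /cmp !ltnn /=; ring.
have -> /= : i != abs_perm v j by rewrite -{1}e (inj_eq perm_inj).
rewrite andbT (eq_sym j); case: eqP => [->|_] /=; last by ring.
by rewrite cmp_sqr eq_sym ij /=; ring.
Qed.

(** Let [s] and [f] be the values of [sigma_sum] and [fix_sum] on the class. Four times the mean is
    [n (n - 1) - s (f - 1) - s (n - f) / 3]: fixed points [j] other than [i] weigh 1, moved ones
    1/3. *)
Lemma sum_inv_num (w : Bn n) : w \in C ->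
  \sum_(v in C) (inv_num v)%:R = #|C|%:R * (n%:R * (n%:R - 1) / 4 -
    (n%:R - 3) / 12 * sigma_sum w - 1 / 6 * (sigma_sum w * fix_sum w)).
Proof.
move=> wC.
have e1 : 4 * \sum_(v in C) (inv_num v)%:R = #|C|%:R * (n%:R * (n%:R - 1)) +
    2 * \sum_(v in C) \sum_i \sum_j
      eps v i * (cmp i j * (abs_perm v j < abs_perm v i)%:R).
  rewrite !mulr_sumr mulr_natl -sumr_const -big_split.
  by apply: eq_bigr => v _; rewrite inv_numE.
rewrite sum_eps_cmp in e1.
have e2 := sum_sigma_distinct.
have e4 := sum_sigma_class (-1) 1 wC; have e5 := sum_sigma_class n%:R (-1) wC.
have e6 : \sum_(v in C) \sum_i \sum_j \sum_k
    distinct i j k * (sigma v i * (abs_perm v j == k)%:R) =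
    \sum_(v in C) sigma_sum v * (n%:R + -1 * fix_sum v).
  by apply: eq_bigr => v _; rewrite sigma_distinct_sum mulN1r.
have e7 : \sum_(v in C) \sum_i \sum_j
      sigma v i * (cmp i j * cmp i (abs_perm v j)) =
    \sum_(v in C) sigma_sum v * (-1 + 1 * fix_sum v) +
    \sum_(v in C) \sum_i \sum_j \sum_k
      distinct i j k * (cmp i j * cmp i k) *
      (sigma v i * (abs_perm v j == k)%:R).
  rewrite -big_split; apply: eq_bigr => v _.
  by rewrite sum_sigma_split mul1r [-1 + _]addrC.
rewrite e6 e5 in e2; rewrite e7 e4 in e1.
move: e1 e2; set x := \sum_(v in C) _; set y := \sum_(v in C) _ => e1 e2.
have -> : x = (#|C|%:R * (n%:R * (n%:R - 1)) -
  (#|C|%:R * (sigma_sum w * (-1 + 1 * fix_sum w)) + y)) / 4 by lra.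
have -> : y = #|C|%:R * (sigma_sum w * (n%:R + -1 * fix_sum w)) / 3 by lra.
by field.
Qed.

Lemma sum_neg_sum (w : Bn n) : w \in C ->
  \sum_(v in C) - (neg_sum v)%:~R =
  #|C|%:R * ((n%:R + 1) / 4 * (n%:R - sigma_sum w)).
Proof.
move=> wC.
have e1 : 4 * \sum_(v in C) - (neg_sum v)%:~R = #|C|%:R * (n%:R * (n%:R + 1)) -
    2 * \sum_(v in C) \sum_i eps v i * (abs_perm v i).+1%:R.
  rewrite !mulr_sumr mulr_natl -sumr_const -sumrB.
  by apply: eq_bigr => v _; rewrite mulrN -mulNr neg_sumE mulr_sumr.
have e2 : \sum_(v in C) \sum_i eps v i * (abs_perm v i).+1%:R =
    \sum_(v in C) \sum_i sigma v i * i.+1%:R.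
  rewrite exchange_big [RHS]exchange_big; apply: eq_bigr => i _ /=.
  rewrite (sum_eps (fun p => (p i).+1%:R)); apply: eq_bigr => v _.
  by rewrite /sigma; case: eqP => [->|_] //; rewrite !mulr0 !mul0r.
(* Reversal replaces [i.+1] by [n - i], so the two copies of the weight add up to [n + 1]. The term
   [0 * fix_sum v] gives the shape of [sum_sigma_class]. *)
have e3 : 2 * \sum_(v in C) \sum_i sigma v i * i.+1%:R =
    \sum_(v in C) sigma_sum v * (n%:R + 1 + 0 * fix_sum v).
  rewrite mulr_natl mulr2n; pose p := perm (@rev_ord_inj n).
  rewrite -{1}(sum_conj _ (signed_elt p xpred0)) -big_split /=.
  apply: eq_bigr => v _.
  rewrite (reindex_inj (@perm_inj _ p)) -big_split mulr_suml.
  apply: eq_bigr => i _; rewrite sigma_conj permE /= -mulrDr mul0r addr0.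
  by rewrite -natrD natr1; congr (_ * _%:R); have := ltn_ord i; lia.
rewrite e2 e3 (sum_sigma_class _ _ wC) in e1.
move: e1; set x := \sum_(v in C) _ => e1.
have -> : x = (#|C|%:R * (n%:R * (n%:R + 1)) -
  #|C|%:R * (sigma_sum w * (n%:R + 1 + 0 * fix_sum w))) / 4 by lra.
by field.
Qed.

End ConjugacyClass.

Theorem theorem4p17 (n : nat) (C : {set Bn n}) (lambda mu : seq nat)
    (hC : C \in classes [set: Bn n])
    (w : Bn n) (hw : w \in C) (hlm : cycle_type w = (lambda, mu)) :
  expectation C (fun v => (inv_num v)%:Z) =
    n%:R * (n%:R - 1) / 4 - (n%:R - 3) / 12 * Delta 1 lambda mu
      - 1 / 6 * Delta 2 lambda mu
  /\
  expectation C (@inv_B n) =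
    n%:R ^+ 2 / 2 - n%:R / 3 * Delta 1 lambda mu
      - 1 / 6 * Delta 2 lambda mu.
Proof.
have [-> ->] := Delta_cycle_type hlm.
have C0 : #|C|%:R != 0 :> rat.
  by rewrite pnatr_eq0 -lt0n; apply/card_gt0P; exists w.
split; rewrite /expectation.
  by rewrite (sum_inv_num hC hw) mulrC mulKf.
have -> : \sum_(v in C) (inv_B v)%:~R =
    \sum_(v in C) (inv_num v)%:R + \sum_(v in C) - (neg_sum v)%:~R :> rat.
  by rewrite -big_split; apply: eq_bigr => v _; rewrite /inv_B rmorphB.
rewrite (sum_inv_num hC hw) (sum_neg_sum hC hw) -mulrDr mulrC mulKf //.
(* [n (n - 1) / 4 + n (n + 1) / 4 = n ^ 2 / 2] and [(n - 3) / 12 + (n + 1) / 4 = n / 3]. *)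
by field.
Qed.
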